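(* For $j\in\mathbb{N}=\{1,2,\dots\}$ let $a_j=\frac25+\frac15\cdot\frac{2^{j-1}-1}{2^{j-1}}$, let $\nu$ be the discrete probability measure on $\mathbb{R}$ with $\nu(\{a_j\})=\frac1{2^j}$ for all $j\in\mathbb{N}$, and let $b_k=\dfrac{\sum_{j=k}^\infty a_j2^{-j}}{\sum_{j=k}^\infty2^{-j}}$ for $k\in\mathbb{N}$. Then for every $n\ge2$ the set $\alpha_n=\{a_1,a_2,\dots,a_{n-1},b_n\}$ is an optimal set of $n$-means for $\nu$ (with respect to the squared Euclidean distance), and the corresponding quantization error is $$V_n(\nu)=\frac{2^{6-3n}}{1575}.$$
   Context: For $n\in\mathbb{N}$, the $n$th quantization error (of order $2$, with respect to the Euclidean distance on $\mathbb{R}$) of $\nu$ is $V_n(\nu)=\inf\{\int\min_{a\in A}(x-a)^2\,d\nu(x):A\subset\mathbb{R},\ 1\le\mathrm{card}(A)\le n\}$. A set $A\subset\mathbb{R}$ with $\mathrm{card}(A)\le n$ for which this infimum is attained is called an optimal set of $n$-means for $\nu$. The number $b_k$ is the conditional expectation $E(X: X\in A_k)$ of a random variable $X$ with distribution $\nu$, where $A_k=\{a_k,a_{k+1},\dots\}$. *)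

(* Defs.v *)
From HB Require Import structures.
From mathcomp Require Import all_boot all_order all_algebra.
From mathcomp Require Import all_classical all_reals all_analysis.
From mathcomp Require Import ring lra.
Import Order.TTheory GRing.Theory Num.Theory.
Import numFieldNormedType.Exports.

Set Implicit Arguments.
Unset Strict Implicit.
Unset Printing Implicit Defensive.

Local Open Scope classical_set_scope.
Local Open Scope ring_scope.

Section quantization.
Context {R : realType}.
Variable mu : {measure set (measurableTypeR R) -> \bar R}.

(* Only used for [A] finite and nonempty, in which case the infimum below is
   the minimum of [(x - c) ^+ 2] over [c] in [A]. *)
Definition distortion (A : set R) : \bar R :=
  (\int[mu]_x (inf [set (x - c) ^+ 2 | c in A])%:E)%E.

(* The sets [A] with [1 <= card A <= n]. *)
Definition codebooks (n : nat) : set (set R) :=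
  [set A | A !=set0 /\ (A #<= `I_n)%card].

Definition quantization_error (n : nat) : \bar R :=
  ereal_inf [set distortion A | A in codebooks n].

Definition optimal_means (n : nat) (A : set R) : Prop :=
  codebooks n A /\ distortion A = quantization_error n.

End quantization.

Section dyadic.
Variable R : realType.

(* Indices start at 1; the junk value [atom 0] is never used. *)
Definition atom (j : nat) : R :=
  2 / 5 + 1 / 5 * ((2 ^+ j.-1 - 1) / 2 ^+ j.-1).

Definition tail_mean (k : nat) : R :=
  limn (fun m => \sum_(k <= j < m) atom j * 2 ^- j) /
  limn (fun m => \sum_(k <= j < m) (2 ^- j : R)).

Fact weight_ge0 (j : nat) : 0 <= 2 ^- j :> R.
Proof. by rewrite invr_ge0 exprn_ge0. Qed.

Definition nu : set (measurableTypeR R) -> \bar R :=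
  mseries (fun j => mscale (NngNum (weight_ge0 j)) \d_(atom j : measurableTypeR R)) 1.

HB.instance Definition _ := Measure.on nu.

Lemma nuE (A : set (measurableTypeR R)) :
  nu A = (\sum_(1 <= j <oo) (2 ^- j * \1_A (atom j))%:E)%E.
Proof. by []. Qed.

Let sum_weight : (\sum_(1 <= j <oo) (2 ^- j : R)%:E = 1)%E.
Proof.
rewrite -nneseries_addn => [|j]; last by rewrite lee_fin weight_ge0.
apply/cvg_lim => //.
have := @cvg_geometric_series_half R 1 0; rewrite expr0 divr1 => h.
rewrite (_ : (fun _ => _) = EFin \o series (fun k => 1 / (2 ^ (k + 1))%:R : R^o)).
  exact: cvg_comp h _.
apply/funext => m /=; rewrite /series /= -sumEFin.
by apply: eq_bigr => j _; rewrite natrX mul1r.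
Qed.

Let nu_setT : nu setT = 1%E.
Proof.
rewrite nuE -sum_weight; apply: eq_eseriesr => j _.
by rewrite indicE in_setT mulr1.
Qed.

HB.instance Definition _ := Measure_isProbability.Build _ _ R nu nu_setT.

Let atomE j : (0 < j)%N -> atom j = 3 / 5 - 2 / 5 * 2 ^- j.
Proof.
case: j => // j _; rewrite /atom /= exprS.
have : 2 ^+ j != 0 :> R by rewrite expf_neq0.
by move: (2 ^+ j) => x x0; field.
Qed.

Lemma atom_inj : {in [pred j | (0 < j)%N] &, injective atom}.
Proof.
move=> i j i0 j0; rewrite !atomE// => /addrI/oppr_inj/mulfI h.
have /invr_inj : 2 ^- i = 2 ^- j :> R by apply: h; rewrite mulf_neq0 ?invr_eq0 ?pnatr_eq0.
by apply: ieexprIn; [lra|rewrite (eqr_nat R 2 1)].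
Qed.

Lemma nu_atom (j : nat) : (0 < j)%N -> nu [set atom j] = (2 ^- j)%:E.
Proof.
move=> j0; rewrite nuE -nneseries_addn => [|i]; last first.
  by rewrite lee_fin mulr_ge0// weight_ge0.
rewrite (@nneseriesD1 _ _ j.-1)//.
rewrite addn1 prednK// indicE mem_set// mulr1 ereal_series_cond eseries0 ?adde0//.
move=> i _ ij; rewrite indicE memNset ?mulr0// => /= /atom_inj.
rewrite !inE addn1 => h.
by move: ij; rewrite -(h isT j0) eqxx.
Qed.

End dyadic.

Arguments nu : clear implicits.

(* Main.v *)
Require Import Defs.
From mathcomp Require Import all_boot all_order all_algebra.
From mathcomp Require Import all_classical all_reals all_analysis.
From mathcomp Require Import measurable_realfun ring lra.
Import Order.TTheory GRing.Theory Num.Theory.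
Import numFieldNormedType.Exports.

(** Write t_j = 2^-j, so that the atom of mass t_j sits at
    a_j = 3/5 - (2/5) t_j, and let d_A(x) be the least squared distance from x
    to A.  Since the measure is a countable sum of point masses, the distortion
    of A is the series of the t_j d_A(a_j), j >= 1 ([distortion_nu]).

    Upper bound: the proposed set makes no error on a_1, ..., a_(n-1) and at
    most (a_j - b_n)^2 on the later atoms, so it costs at most the second
    moment of the tail a_n, a_(n+1), ... about its barycentre b_n.  The powers
    t_j, t_j^2 and t_j^3 all telescope, which evaluates this moment to
    (64/1575) t_n^3 ([cvg_tail_distortion]).

    Lower bound: let A have at most n points.  Among the n+1 atoms
    a_1, ..., a_n, a_j with j > n, two must have the same nearest point in A.
    A Voronoi cell is convex and a_n lies between a_i and a_j for i < n < j,
    so one of two things happens ([nearest_dichotomy]).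
    - Two of a_1, ..., a_n share their nearest point.  As the gap and the
      masses decrease geometrically, these two atoms alone already cost
      (8/75) t_n^3, which exceeds (64/1575) t_n^3 ([pair_distortion]).
    - All of a_n, a_(n+1), ... have a common nearest point c.  By the parallel
      axis theorem the tail then costs (64/1575) t_n^3 plus its mass times
      (b_n - c)^2.
    In both cases the cost is at least the upper bound. *)

Set Implicit Arguments.
Unset Strict Implicit.
Unset Printing Implicit Defensive.

Local Open Scope classical_set_scope.
Local Open Scope ring_scope.

(** * Nearest points of a codebook *)

Section nearest_points.
Context {R : realType}.
Implicit Types (A : set R) (x y z c : R).

Definition sqdist A x : R := inf [set (x - c) ^+ 2 | c in A].

Definition nearest A x c :=
  A c /\ forall a, A a -> (x - c) ^+ 2 <= (x - a) ^+ 2.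

Lemma sqdist_lbound A x : has_lbound [set (x - c) ^+ 2 | c in A].
Proof. by exists 0 => _ [c _ <-]; exact: sqr_ge0. Qed.

Lemma sqdist_le A x c : A c -> sqdist A x <= (x - c) ^+ 2.
Proof. by move=> Ac; apply: ge_inf; [exact: sqdist_lbound|exists c]. Qed.

Lemma sqdist_ge0 A x : A !=set0 -> 0 <= sqdist A x.
Proof.
move=> [a Aa]; apply: lb_le_inf; first by exists ((x - a) ^+ 2), a.
by move=> _ [c _ <-]; exact: sqr_ge0.
Qed.

Lemma sqdist_nearest A x c : nearest A x c -> sqdist A x = (x - c) ^+ 2.
Proof.
move=> [Ac cmin]; apply/eqP; rewrite eq_le sqdist_le//=.
by apply: lb_le_inf => [|_ [a Aa <-]]; [exists ((x - c) ^+ 2), c|exact: cmin].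
Qed.

Lemma ex_nearest A x : finite_set A -> A !=set0 -> exists c, nearest A x c.
Proof.
move=> /finite_compact cA A0.
have [|c /set_mem Ac cmin] :=
    @compact_EVT_min _ _ (fun c => (x - c) ^+ 2) A A0 cA.
  apply: continuous_subspaceT => c.
  apply: (@continuous_comp _ _ _ (fun c => x - c) (fun y => y ^+ 2)).
    by apply: (@cvgB _ R); [exact: cvg_cst|exact: cvg_id].
  exact: exprn_continuous.
by exists c; split=> // a Aa; apply: cmin; exact/mem_set.
Qed.

(** Voronoi cells are convex: (z - a)^2 - (z - c)^2 is affine in z, so it is
    nonnegative between two points where it is nonnegative. *)
Lemma nearest_between A x y z c :
  x <= z <= y -> nearest A x c -> nearest A y c -> nearest A z c.
Proof.
move=> /andP[xz zy] [Ac xc] [_ yc]; split=> // a Aa.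
have := xc a Aa; have := yc a Aa.
rewrite -![(_ - c) ^+ 2 <= _]subr_ge0 => hy hx.
have [ac|ca] := leP a c.
  have : 0 <= (c - a) * (z - x) by rewrite mulr_ge0// subr_ge0.
  nra.
have : 0 <= (a - c) * (y - z) by rewrite mulr_ge0// subr_ge0// ltW.
nra.
Qed.

(** An infimum of continuous functions is upper semicontinuous: its strict
    sublevel sets are unions of open sets. *)
Lemma measurable_sqdist A : A !=set0 ->
  measurable_fun [set: measurableTypeR R] (sqdist A).
Proof.
move=> A0.
suff : measurable_fun [set: measurableTypeR R] (fun x => - sqdist A x).
  move=> /(measurableT_comp (@oppr_measurable R setT)).
  by apply: eq_measurable_fun => x _ /=; rewrite opprK.
apply/measurable_EFinP; apply: lower_semicontinuous_measurable.
apply/lower_semicontinuousP => a.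
have -> : [set x | (a%:E < (- sqdist A x)%:E)%E] =
    \bigcup_(c in A) ((fun x => (x - c) ^+ 2) @^-1` `]-oo, - a[).
  apply/seteqP; split => x /=.
    rewrite lte_fin ltrNr => /inf_lt[]; last first.
      by move=> _ [c Ac <-] ca; exists c => //=; rewrite in_itv.
    by case: A0 => c Ac; exists ((x - c) ^+ 2), c.
  move=> [c Ac /=]; rewrite in_itv/= => cxa; rewrite lte_fin ltrNr.
  exact: le_lt_trans (sqdist_le x Ac) cxa.
apply: bigcup_open => c Ac; apply: open_comp; last exact: lray_open.
move=> x _; apply: (@continuous_comp _ _ _ (fun x => x - c) (fun y => y ^+ 2)).
  by apply: (@cvgB _ R); [exact: cvg_id|exact: cvg_cst].
exact: exprn_continuous.
Qed.

End nearest_points.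

Lemma pigeonhole_card_le {T : Type} (A : set T) (n : nat) (q : nat -> T) :
  (A #<= `I_n)%card -> (forall i, (i <= n)%N -> A (q i)) ->
  exists i k, [/\ (i < k)%N, (k <= n)%N & q i = q k].
Proof.
move=> An qA; apply: contrapT => noik.
have qinj : {in `I_n.+1 &, injective q}.
  move=> i k; rewrite !inE /= !ltnS => iN kN qik; apply: contrapT => /eqP.
  rewrite neq_ltn => /orP[ik|ki]; apply: noik.
    by exists i, k.
  by exists k, i.
have : (`I_n.+1 #<= `I_n)%card.
  apply: card_le_trans An.
  rewrite -(card_le_eql (inj_card_eq qinj)).
  by apply: subset_card_le => _ [i /= iN <-]; exact: qA.
by rewrite card_le_II ltnn.
Qed.

(** Pigeonhole applied to x_1, ..., x_n and one further x_j.  If the coincidence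
    involves x_j and some x_i with i < n, convexity of the cell moves it to
    the pair x_i, x_n. *)
Lemma nearest_dichotomy {R : realType} (A : set R) (n : nat) (x : nat -> R) :
  {homo x : i j / (i <= j)%N >-> i <= j} ->
  (0 < n)%N -> A !=set0 -> (A #<= `I_n)%card ->
  (exists i k c, [/\ (0 < i < k)%N, (k <= n)%N, nearest A (x i) c &
                     nearest A (x k) c]) \/
  (exists c, forall j, (n <= j)%N -> nearest A (x j) c).
Proof.
move=> xmono n0 A0 An.
have Afin : finite_set A by exact: card_le_finite An (finite_II n).
have [p pP] := choice (fun j => ex_nearest (x j) Afin A0).
have [?|noshare] := pselect (exists i k c, [/\ (0 < i < k)%N, (k <= n)%N,
  nearest A (x i) c & nearest A (x k) c]); [by left|right].
exists (p n) => j; rewrite leq_eqVlt => /orP[/eqP <-//|nj].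
(* The values 0, ..., n-1 encode x_1, ..., x_n, and the value n encodes x_j. *)
have [|i [k [ik kn]]] :=
    @pigeonhole_card_le _ A n (fun i => if (i < n)%N then p i.+1 else p j) An.
  by move=> i _; case: ifP => _; [case: (pP i.+1)|case: (pP j)].
have iltn := leq_trans ik kn; rewrite iltn.
case: ltnP => [kltn pik|nk pij].
  by exfalso; apply: noshare; exists i.+1, k.+1, (p k.+1); rewrite -{1}pik.
have [in_|in_] := eqVneq i.+1 n; first by rewrite -in_ pij.
exfalso; apply: noshare; exists i.+1, n, (p j); split => //.
- by rewrite /= ltn_neqAle in_.
- by rewrite -pij.
- apply: (@nearest_between _ A (x i.+1) (x j)) => //; last by rewrite -pij.
  by rewrite !xmono// ltnW.
Qed.

(** * Dyadic tail sums *)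

Section dyadic_tails.
Variable R : realType.
Local Notation t j := (2 ^- j : R).

Lemma half_powS j : t j.+1 = t j / 2.
Proof. by rewrite exprS invfM mulrC. Qed.

Lemma atom_half_pow j : (0 < j)%N -> atom R j = 3 / 5 - 2 / 5 * t j.
Proof.
case: j => // j _; rewrite /atom /= exprS.
have : 2 ^+ j != 0 :> R by rewrite expf_neq0.
by move: (2 ^+ j) => x x0; field.
Qed.

Lemma half_pow_le i j : (i <= j)%N -> t j <= t i.
Proof.
by move=> ij; rewrite lef_pV2 ?posrE ?exprn_gt0// ler_weXn2l// ler1n.
Qed.

(** Index 0 gives the same value as index 1, because 0.-1 = 0; hence
    monotonicity holds from 0 on. *)
Lemma atom_le : {homo atom R : i j / (i <= j)%N >-> i <= j}.
Proof.
have atom01 : atom R 0 = atom R 1 by [].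
suff main i j : (0 < i)%N -> (i <= j)%N -> atom R i <= atom R j.
  move=> [|i] [|j] // ij; last exact: main.
  by rewrite atom01; exact: main.
move=> i0 ij; rewrite !atom_half_pow ?(leq_trans i0)//.
have := half_pow_le ij; lra.
Qed.

Lemma cvg_half_pow : t j @[j --> \oo] --> (0 : R).
Proof.
under eq_fun do rewrite -exprVn.
by apply: cvg_expr; rewrite ger0_norm; lra.
Qed.

(** Evaluates every tail series met here: for u_j a polynomial in t_j without
    constant term, a suitable p is found degree by degree, because
    x^d - (x/2)^d is a nonzero multiple of x^d for d >= 1. *)
Lemma cvg_dyadic_telescope (p : {poly R}) (u : nat -> R) (n : nat) :
  p.[0] = 0 -> (forall j, (n <= j)%N -> u j = p.[t j] - p.[t j / 2]) ->
  \sum_(n <= j < m) u j @[m --> \oo] --> p.[t n].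
Proof.
move=> p0 up.
have h : p.[t n] - p.[t m] @[m --> \oo] --> p.[t n].
  rewrite -[X in _ --> X]subr0 -p0.
  apply: cvgB; first exact: cvg_cst.
  exact: (cvg_comp _ _ cvg_half_pow (@continuous_horner R p 0)).
apply: cvg_trans h; apply: near_eq_cvg; near=> m.
have nm : (n <= m)%N by near: m; exact: nbhs_infty_ge.
rewrite -[LHS]opprB -(telescope_sumr (fun j => p.[t j]) nm) -sumrN.
apply: eq_big_nat => j /andP[nj _].
by rewrite up// opprB half_powS.
Unshelve. all: by end_near. Qed.

Lemma tail_meanE n : (0 < n)%N -> tail_mean R n = 3 / 5 - 4 / 15 * t n.
Proof.
move=> n0.
have massE : \sum_(n <= j < m) t j @[m --> \oo] --> 2 * t n.
  pose p : {poly R} := 2 *: 'X.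
  have -> : 2 * t n = p.[t n] by rewrite !hornerE.
  apply: cvg_dyadic_telescope => [|j _]; rewrite !hornerE//=.
  by move: (t j) => x; field.
have momentE : \sum_(n <= j < m) atom R j * t j @[m --> \oo] -->
    2 * t n * (3 / 5 - 4 / 15 * t n).
  pose p : {poly R} := 2 *: 'X * ((3 / 5)%:P - (4 / 15) *: 'X).
  have -> : 2 * t n * (3 / 5 - 4 / 15 * t n) = p.[t n] by rewrite !hornerE.
  apply: cvg_dyadic_telescope => [|j nj]; rewrite !hornerE//=.
  rewrite atom_half_pow ?(leq_trans n0)//.
  by move: (t j) => x; field.
rewrite /tail_mean (cvg_lim _ momentE)// (cvg_lim _ massE)//.
by rewrite mulrAC divff ?mul1r// mulf_neq0 ?invr_eq0 ?expf_neq0.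
Qed.

(** Parallel axis theorem for the atoms of index at least n: variance term,
    plus total mass 2 t_n times the squared offset from the barycentre. *)
Lemma cvg_tail_distortion n c : (0 < n)%N ->
  \sum_(n <= j < m) t j * (atom R j - c) ^+ 2 @[m --> \oo] -->
  64 / 1575 * t n ^+ 3 + 2 * t n * (tail_mean R n - c) ^+ 2.
Proof.
move=> n0; rewrite tail_meanE//.
pose p : {poly R} := (64 / 1575) *: 'X^3 +
  2 *: 'X * ((3 / 5)%:P - (4 / 15) *: 'X - c%:P) ^+ 2.
rewrite [X in _ --> X](_ : _ = p.[t n]); last by rewrite !hornerE.
apply: cvg_dyadic_telescope => [|j nj]; rewrite !hornerE/=.
  by rewrite !(mulr0, mul0r, addr0).
rewrite atom_half_pow ?(leq_trans n0)//.
by move: (t j) => x; field.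
Qed.

(** With s = t_i and r = t_k one has s >= 2 r, so the cost is at least
    r (2 X^2 + Y^2), where X and Y are the signed errors.  Minimizing over c
    gives 2 X^2 + Y^2 >= (2/3) (X - Y)^2, and X - Y = - (2/5) (s - r) has
    absolute value at least (2/5) r. *)
Lemma pair_distortion i k c : (0 < i < k)%N ->
  8 / 75 * t k ^+ 3 <=
  t i * (atom R i - c) ^+ 2 + t k * (atom R k - c) ^+ 2.
Proof.
move=> /andP[i0 ik]; rewrite !atom_half_pow ?(leq_trans i0 (ltnW ik))//.
have k0 : 0 < t k by rewrite invr_gt0 exprn_gt0.
have : 2 * t k <= t i by have := half_pow_le ik; rewrite half_powS; lra.
move: (t i) (t k) k0 => s r r0 rs.
set X := 3 / 5 - 2 / 5 * s - c; set Y := 3 / 5 - 2 / 5 * r - c.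
apply: (@le_trans _ _ (r * (2 * X ^+ 2 + Y ^+ 2))); last first.
  have : 0 <= (s - 2 * r) * X ^+ 2 by rewrite mulr_ge0 ?sqr_ge0// subr_ge0.
  lra.
have -> : 8 / 75 * r ^+ 3 = r * (8 / 75 * r ^+ 2) by ring.
rewrite ler_pM2l//.
have XY : 4 / 25 * r ^+ 2 <= (Y - X) ^+ 2.
  have -> : Y - X = 2 / 5 * (s - r) by rewrite /X /Y; ring.
  nra.
(* 3 (2 X^2 + Y^2) - 2 (Y - X)^2 = (2 X + Y)^2 *)
have := sqr_ge0 (2 * X + Y); nra.
Qed.

End dyadic_tails.

(** * The distortion of the dyadic measure *)

Section distortion_nu.
Variable R : realType.
Local Notation t j := (2 ^- j : R).

Local Notation dyadic_means n :=
  ([set atom R j | j in [set j | (1 <= j <= n.-1)%N]] `|`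
   [set tail_mean R n]).

Lemma distortion_nu (A : set R) : A !=set0 ->
  distortion (nu R) A =
  (\sum_(1 <= j <oo) (t j * sqdist A (atom R j))%:E)%E.
Proof.
move=> A0; rewrite [LHS](_ : _ = \int[nu R]_x (sqdist A x)%:E)%E//.
(* The same measure with its atoms indexed from 0. *)
pose m j : {measure set (measurableTypeR R) -> \bar R} :=
  mscale (NngNum (weight_ge0 R j.+1)) \d_(atom R j.+1 : measurableTypeR R).
have mA : measurable_fun setT (fun x : measurableTypeR R => (sqdist A x)%:E).
  by apply/measurable_EFinP; exact: measurable_sqdist.
rewrite (@eq_measure_integral _ _ _ setT (mseries m 0)); last first.
  move=> B mB _; apply: (etrans (nuE B)); rewrite -nneseries_addn; last first.
    by move=> j; rewrite lee_fin mulr_ge0 ?weight_ge0.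
  apply: eq_eseriesr => j _; rewrite addn1 /m /= /mscale/= diracE indicE.
  by rewrite EFinM.
rewrite ge0_integral_measure_series//; last first.
  by move=> x _; rewrite lee_fin sqdist_ge0.
rewrite -(@nneseries_addn _ _ 1); last first.
  by move=> j; rewrite lee_fin mulr_ge0 ?weight_ge0 ?sqdist_ge0.
apply: eq_eseriesr => j _; rewrite /m ge0_integral_mscale//; last first.
  by move=> x _; rewrite lee_fin sqdist_ge0.
by rewrite integral_dirac// diracT mul1e addn1 EFinM.
Qed.

Lemma tail_eseries n c : (0 < n)%N ->
  (\sum_(n <= j <oo) (t j * (atom R j - c) ^+ 2)%:E =
   (64 / 1575 * t n ^+ 3 + 2 * t n * (tail_mean R n - c) ^+ 2)%:E)%E.
Proof.
move=> n0; apply/cvg_lim => //.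
under eq_fun do rewrite sumEFin.
apply: cvg_EFin; first exact: nearW.
exact: cvg_tail_distortion.
Qed.

Lemma distortion_nu_ge n (A : set R) : (0 < n)%N -> codebooks n A ->
  ((64 / 1575 * t n ^+ 3)%:E <= distortion (nu R) A)%E.
Proof.
move=> n0 [A0 An]; rewrite distortion_nu//.
have d0 j : 0 <= t j * sqdist A (atom R j).
  by rewrite mulr_ge0 ?weight_ge0 ?sqdist_ge0.
case: (@nearest_dichotomy R A n (atom R) (@atom_le R) n0 A0 An).
  move=> [i [k [c [/andP[i0 ik] kn ic kc]]]].
  apply: le_trans (nneseries_lim_ge n.+1 _); last by move=> *; rewrite lee_fin.
  rewrite sumEFin lee_fin.
  rewrite (bigD1_seq i) ?iota_uniq ?mem_index_iota ?i0 ?ltnS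
    ?(leq_trans (ltnW ik))//=.
  rewrite -big_filter (bigD1_seq k) ?filter_uniq ?iota_uniq//=; last first.
    by rewrite mem_filter gtn_eqF// mem_index_iota (leq_trans i0 (ltnW ik)).
  rewrite addrA ler_wpDr ?sumr_ge0//.
  rewrite (sqdist_nearest ic) (sqdist_nearest kc).
  apply: le_trans (pair_distortion c _); last by rewrite i0.
  have : t n ^+ 3 <= t k ^+ 3.
    by rewrite lerXn2r ?nnegrE ?weight_ge0// half_pow_le.
  have : 0 <= t k ^+ 3 by rewrite exprn_ge0// weight_ge0.
  lra.
move=> [c cP].
rewrite (nneseries_split 1 n.-1) ?add1n ?prednK//; last first.
  by move=> *; rewrite lee_fin.
apply: (@le_trans _ _ (\sum_(n <= j <oo) (t j * (atom R j - c) ^+ 2)%:E)%E).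
  rewrite tail_eseries// lee_fin lerDl.
  by rewrite mulr_ge0 ?sqr_ge0// mulr_ge0// weight_ge0.
rewrite -[leLHS]add0e leeD//.
  by rewrite sume_ge0// => *; rewrite lee_fin.
rewrite !ereal_series.
rewrite (eq_eseriesr (g := fun j => (t j * sqdist A (atom R j))%:E))//.
by move=> j nj; rewrite (sqdist_nearest (cP j nj)).
Qed.

Lemma means_codebook n : (0 < n)%N -> codebooks n (dyadic_means n).
Proof.
move=> n0; split; first by exists (tail_mean R n); right.
pose q i := if (i < n.-1)%N then atom R i.+1 else tail_mean R n.
apply: card_le_trans (card_image_le q `I_n).
apply: subset_card_le => _ [[j /= /andP[j0 jn] <-]|->].
  exists j.-1; first by rewrite /= prednK// (leq_trans jn)// leq_pred.
  by rewrite /q prednK// jn.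
by exists n.-1; rewrite /= ?prednK// /q ltnn.
Qed.

Lemma distortion_means_le n : (0 < n)%N ->
  (distortion (nu R) (dyadic_means n) <= (64 / 1575 * t n ^+ 3)%:E)%E.
Proof.
move=> n0; have [A0 _] := means_codebook n0.
rewrite distortion_nu//; move: A0; set A := _ `|` _ => A0.
have d0 j : 0 <= t j * sqdist A (atom R j).
  by rewrite mulr_ge0 ?weight_ge0 ?sqdist_ge0.
rewrite (nneseries_split 1 n.-1) ?add1n ?prednK//; last first.
  by move=> *; rewrite lee_fin.
have -> : (64 / 1575 * t n ^+ 3)%:E =
    (\sum_(n <= j <oo) (t j * (atom R j - tail_mean R n) ^+ 2)%:E)%E :> \bar R.
  by rewrite tail_eseries// subrr expr0n/= mulr0 addr0.
rewrite -[leRHS]add0e leeD//.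
  rewrite sumEFin lee_fin big_nat sumr_le0// => j /andP[j1 jn].
  suff : sqdist A (atom R j) <= 0 by have := weight_ge0 R j; nra.
  rewrite (le_trans (@sqdist_le _ A _ (atom R j) _))//; last first.
    by rewrite subrr expr0n.
  by left; exists j => //=; rewrite j1 -ltnS prednK.
apply: lee_nneseries => [j _ _|j _]; rewrite lee_fin//.
by rewrite ler_wpM2l ?weight_ge0// sqdist_le//; right.
Qed.

Lemma pow2_error n :
  (2 : R) ^ (6%:Z - 3%:Z * n%:Z) / 1575 = 64 / 1575 * t n ^+ 3.
Proof.
rewrite expfzDr ?pnatr_eq0// -PoszM -exprnN mulnC exprM -exprnP exprVn.
have : (2 ^+ n) ^+ 3 != 0 :> R by rewrite !expf_neq0.
by move: (_ ^+ 3) => x x0; field.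
Qed.

End distortion_nu.

Theorem proposition4p5 (R : realType) (n : nat) (hn : (2 <= n)%N) :
  optimal_means (nu R) n
    ([set atom R j | j in [set j | (1 <= j <= n.-1)%N]] `|` [set tail_mean R n])
  /\ quantization_error (nu R) n = ((2 : R) ^ (6%:Z - 3%:Z * n%:Z) / 1575)%:E.
Proof.
have n0 : (0 < n)%N by exact: ltnW.
have cbA := means_codebook R n0.
have dA := distortion_means_le R n0.
have VA := ereal_inf_lbound (imageP (distortion (nu R)) cbA).
have V_ge : ((64 / 1575 * 2 ^- n ^+ 3)%:E <= quantization_error (nu R) n)%E.
  by apply: le_ereal_inf_tmp => _ [A cA <-]; exact: distortion_nu_ge.
rewrite pow2_error; split.
  by split=> //; apply/eqP; rewrite eq_le VA andbT (le_trans dA).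
by apply/eqP; rewrite eq_le V_ge andbT (le_trans VA).
Qed.
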